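(* Let $a\in\mathbb{C}$ with $|a|<1$ and let $f\in C(\mathbb{T})$. Then $$\|f-\sigma_n^a(f)\|_\infty\to0\qquad (n\to\infty).$$
   Context: $\mathbb{T}=\mathbb{R}/2\pi\mathbb{Z}$; functions on $\mathbb{T}$ are real- or complex-valued and identified with $2\pi$-periodic functions on $\mathbb{R}$; $C(\mathbb{T})$ is the space of continuous ones and $\|\cdot\|_\infty$ the (essential) supremum norm. For $a=|a|e^{it_a}$, $|a|<1$, the nonlinear phase function $\theta_a:\mathbb{R}\to\mathbb{R}$ is the continuous function with $e^{i\theta_a(t)}=\dfrac{e^{it}-a}{1-\overline{a}e^{it}}$ (a fixed choice of continuous branch). It is strictly increasing, satisfies $\theta_a(t+2\pi)=\theta_a(t)+2\pi$, and has derivative the Poisson kernel $\theta_a'(t)=p_a(t)=\dfrac{1-|a|^2}{1-2|a|\cos(t-t_a)+|a|^2}$. For $f\in L^1(\mathbb{T})$, $c_k(f)=\dfrac1{2\pi}\displaystyle\int_{-\pi}^{\pi}f(t)e^{-ik\theta_a(t)}p_a(t)\,dt$ for $k\in\mathbb{Z}$, $S_n^a(f)(x)=\displaystyle\sum_{k=-n}^{n}c_k(f)e^{ik\theta_a(x)}$, and the $n$-th Fejér (Cesàro) mean is $\sigma_n^a(f)(x)=\dfrac1{n+1}\displaystyle\sum_{k=0}^{n}S_k^a(f)(x)$. *)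

(* Defs.v *)
(* Stdlib reals + Coquelicot. *)
From Stdlib Require Import Reals ZArith.
From Coquelicot Require Import Coquelicot.
Open Scope R_scope.

(* Functions on T = R/2piZ are 2pi-periodic functions R -> C; the real-valued
   ones are included through the coercion RtoC. *)

(* e^{it} *)
Definition cis (t : R) : C := (cos t, sin t).

(* f belongs to C(T) *)
Definition continuous_on_T (f : R -> C) : Prop :=
  (forall t : R, f (t + 2 * PI) = f t) /\ (forall t : R, continuous f t).

(* theta is a continuous branch of the phase of the Blaschke factor of a;
   the denominator does not vanish when |a| < 1. *)
Definition nonlinear_phase (a : C) (theta : R -> R) : Prop :=
  (forall t : R, continuous theta t) /\
  (forall t : R,
     cis (theta t) = ((cis t - a) / (1 - Cconj a * cis t))%C).

(* p_a, where a = |a| e^{i ta} *)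
Definition poisson_kernel (a : C) (ta t : R) : R :=
  (1 - Cmod a ^ 2) / (1 - 2 * Cmod a * cos (t - ta) + Cmod a ^ 2).

(* c_k(f).  RInt is the Riemann integral of a C-valued function of a real
   variable; it agrees with the Lebesgue integral when f is in C(T), the only
   case in which this definition is meant to be used. *)
Definition coef (a : C) (ta : R) (theta : R -> R) (f : R -> C) (k : Z) : C :=
  (RtoC (/ (2 * PI)) *
   RInt (V := C_R_CompleteNormedModule)
     (fun t : R =>
        f t * cis (- (IZR k * theta t)) * RtoC (poisson_kernel a ta t))
     (- PI) PI)%C.

(* S_n^a(f)(x): the sum over k = -n, ..., n is indexed by j = k + n, and
   [sum_n u N] is u 0 + ... + u N. *)
Definition partial_sum (a : C) (ta : R) (theta : R -> R) (f : R -> C)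
    (n : nat) (x : R) : C :=
  sum_n (fun j : nat =>
           let k := (Z.of_nat j - Z.of_nat n)%Z in
           (coef a ta theta f k * cis (IZR k * theta x))%C)
        (2 * n).

(* sigma_n^a(f)(x) *)
Definition fejer_mean (a : C) (ta : R) (theta : R -> R) (f : R -> C)
    (n : nat) (x : R) : C :=
  (RtoC (/ INR (n + 1)) *
   sum_n (fun k : nat => partial_sum a ta theta f k x) n)%C.

(* Supremum norm with values in [0, +oo]; it coincides with the essential
   supremum norm on continuous functions. *)
Definition sup_norm (g : R -> C) : Rbar :=
  Lub_Rbar (fun r : R => exists x : R, r = Cmod (g x)).

(* Main.v *)
Require Import Defs.
From Stdlib Require Import Reals ZArith Lra Lia.
From Coquelicot Require Import Coquelicot.
Open Scope R_scope.

(** The means depend on the branch theta only through e^{i theta}, because the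
    coefficients use integer multiples of theta only.  So theta may be replaced
    by one explicit smooth branch,
      Theta(t) = t + 2 atan (r sin (t - ta) / (1 - r cos (t - ta))),  r = |a|
    ([cis_phase], [fejer_mean_phase_congr]), for which Theta' = p_a and
    Theta(t + 2 pi) = Theta(t) + 2 pi can be computed.

    Exchanging sum and integral, sigma_n(f)(x) is the average of f against
      p_a(t) K_n(Theta(x) - Theta(t)) / (2 pi (n + 1)) dt,
    with K_n = D_0 + ... + D_n the unnormalised Fejer kernel
    ([is_RInt_fejer_mean]).  This is an approximate identity:
    - it has total mass 1, since p_a(t) cos(j (Theta(x) - Theta(t))) has a
      periodic antiderivative for j > 0 and p_a itself integrates to
      Theta(pi) - Theta(-pi) = 2 pi ([is_RInt_poisson_fejer]);
    - it is nonnegative, and it concentrates on the diagonal, both because of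
        (1 - cos u) K_n(u) = 1 - cos((n + 1) u)     ([fejer_telescope]).

    The conclusion follows Korovkin's argument.  By uniform continuity and
    boundedness of f, for each eps there is M with
      |f(x) - f(t)| <= eps + M (1 - cos(x - t))     ([oscillation_le_chord]),
    and the Blaschke factor contracts chords of the circle by a bounded ratio
    only ([phase_expands]), so that 1 - cos(x - t) is at most a constant times
    1 - cos(Theta(x) - Theta(t)).  Integrating against the kernel, the telescoped
    identity gives |f - sigma_n(f)| <= eps + M' / (n + 1) uniformly in x
    ([fejer_mean_error]). *)

(** * The circle *)

Lemma cis_add (x y : R) : cis (x + y) = (cis x * cis y)%C.
Proof.
  unfold cis, Cmult; simpl; rewrite cos_plus, sin_plus.
  apply injective_projections; simpl; ring.
Qed.

Lemma cis_opp (x : R) : cis (- x) = Cconj (cis x).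
Proof. unfold cis, Cconj; simpl; now rewrite cos_neg, sin_neg. Qed.

Lemma Cmod_sqr (z : C) : Cmod z ^ 2 = fst z ^ 2 + snd z ^ 2.
Proof.
  unfold Cmod; apply pow2_sqrt.
  generalize (pow2_ge_0 (fst z)) (pow2_ge_0 (snd z)); lra.
Qed.

Lemma Cmod_cis (x : R) : Cmod (cis x) = 1.
Proof.
  unfold Cmod, cis; simpl fst; simpl snd; rewrite <- sqrt_1; f_equal.
  generalize (sin2_cos2 x); unfold Rsqr; simpl; lra.
Qed.

Lemma cis_chord_sqr (x y : R) : Cmod (cis x - cis y) ^ 2 = 2 * (1 - cos (x - y)).
Proof.
  rewrite Cmod_sqr, cos_minus; simpl.
  generalize (sin2_cos2 x) (sin2_cos2 y); unfold Rsqr; lra.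
Qed.

Lemma cis_nat_multiple_eq (x y : R) (n : nat) :
  cis x = cis y -> cis (INR n * x) = cis (INR n * y).
Proof.
  intros H; induction n as [|n IH].
  - now rewrite !Rmult_0_l.
  - rewrite S_INR, !Rmult_plus_distr_r, !Rmult_1_l, !cis_add, IH, H; reflexivity.
Qed.

(** Integer harmonics of a phase see only the point of the circle that it
    names; this is what makes the choice of a branch irrelevant. *)
Lemma cis_int_multiple_eq (x y : R) (k : Z) :
  cis x = cis y -> cis (IZR k * x) = cis (IZR k * y).
Proof.
  intros H; destruct (Z_le_gt_dec 0 k) as [Hk|Hk].
  - rewrite <- (Z2Nat.id k) by lia; rewrite <- !INR_IZR_INZ.
    now apply cis_nat_multiple_eq.
  - replace k with (- Z.of_nat (Z.to_nat (- k)))%Z by lia.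
    rewrite opp_IZR, <- INR_IZR_INZ, !Ropp_mult_distr_l_reverse, !cis_opp.
    f_equal; now apply cis_nat_multiple_eq.
Qed.

(** * The phase *)

(** With w = 1 - r e^{i (t - ta)}, the Blaschke factor is e^{it} conj(w) / w, and
    Re w > 0, so the principal argument of w is an arctangent. *)
Definition phase (r ta t : R) : R :=
  t + 2 * atan (r * sin (t - ta) / (1 - r * cos (t - ta))).

Lemma phase_denominator_pos (r s : R) : 0 <= r < 1 -> 0 < 1 - r * cos s.
Proof. intros Hr; generalize (COS_bound s); nra. Qed.

Lemma poisson_denominator_pos (r s : R) :
  0 <= r < 1 -> 0 < 1 - 2 * r * cos s + r ^ 2.
Proof. intros Hr; generalize (COS_bound s); nra. Qed.

(** conj(w) / w = e^{-2i arg w}, for w = 1 - iq. *)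
Lemma cis_double_atan (q : R) :
  (cis (2 * atan q) * (1%R, (- q)%R) = (1%R, q))%C.
Proof.
  assert (Hq : 0 < 1 + q ^ 2) by nra.
  assert (Hc : cos (atan q) ^ 2 * (1 + q ^ 2) = 1).
  { rewrite cos_atan; unfold Rdiv; rewrite Rmult_1_l, pow_inv, pow2_sqrt.
    - unfold Rsqr; field; nra.
    - unfold Rsqr; nra. }
  assert (Hs : sin (atan q) = q * cos (atan q)).
  { rewrite sin_atan, cos_atan; unfold Rdiv; ring. }
  unfold cis; rewrite cos_2a, sin_2a, Hs.
  apply injective_projections; simpl.
  - transitivity (cos (atan q) ^ 2 * (1 + q ^ 2)); [ring | exact Hc].
  - transitivity (q * (cos (atan q) ^ 2 * (1 + q ^ 2))); [ring | rewrite Hc; ring].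
Qed.

Lemma blaschke_denominator_neq0 (a : C) (t : R) :
  Cmod a < 1 -> (1 - Cconj a * cis t)%C <> 0.
Proof.
  intros Ha H.
  assert (H1 : (Cconj a * cis t = 1)%C).
  { rewrite <- (Cplus_0_r (Cconj a * cis t)%C), <- H; ring. }
  apply (f_equal Cmod) in H1.
  rewrite Cmod_mult, Cmod_cis, Cmod_conj, Cmod_1 in H1; lra.
Qed.

(** Both e^{it} - a = e^{it} conj(w) and 1 - conj(a) e^{it} = w follow from
    a = r e^{i ta}, with w = (1 - r cos s) (1 - iq), s = t - ta; then
    [cis_double_atan] applies. *)
Lemma cis_phase (a : C) (ta t : R) :
  Cmod a < 1 -> a = (RtoC (Cmod a) * cis ta)%C ->
  cis (phase (Cmod a) ta t) = ((cis t - a) / (1 - Cconj a * cis t))%C.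
Proof.
  intros Ha Hta.
  assert (Hd := blaschke_denominator_neq0 a t Ha).
  assert (Hr : 0 <= Cmod a < 1) by (split; [apply Cmod_ge_0 | exact Ha]).
  set (r := Cmod a) in *.
  assert (HD := phase_denominator_pos r (t - ta) Hr).
  set (s := t - ta) in *.
  set (q := r * sin s / (1 - r * cos s)).
  assert (Hw : (1 - Cconj a * cis t = RtoC (1 - r * cos s) * (1%R, (- q)%R))%C).
  { replace t with (s + ta) by (unfold s; ring).
    rewrite Hta, cis_add; clear Hd Hta.
    apply injective_projections; simpl; unfold q; field_simplify; try lra;
    generalize (sin2_cos2 ta); unfold Rsqr; intros Hs.
    all: replace (sin ta ^ 2) with (1 - cos ta ^ 2) by lra; field; lra. }
  assert (Hn : (cis t - a = cis t * (RtoC (1 - r * cos s) * (1%R, q)))%C).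
  { replace t with (s + ta) at 1 2 by (unfold s; ring).
    rewrite Hta, cis_add; clear Hw Hd Hta.
    apply injective_projections; simpl; unfold q; field_simplify; try lra;
    generalize (sin2_cos2 s); unfold Rsqr; intros Hs.
    all: replace (sin s ^ 2) with (1 - cos s ^ 2) by lra; field; lra. }
  rewrite Hn.
  unfold phase; fold s; fold q; rewrite cis_add.
  rewrite <- (cis_double_atan q).
  replace (cis t * (RtoC (1 - r * cos s) * (cis (2 * atan q) * (1%R, (- q)%R))))%C
    with (cis t * cis (2 * atan q) * (1 - Cconj a * cis t))%C
    by (rewrite Hw; ring).
  field; exact Hd.
Qed.

Lemma phase_period (r ta t : R) : phase r ta (t + 2 * PI) = phase r ta t + 2 * PI.
Proof.
  unfold phase; replace (t + 2 * PI - ta) with (t - ta + 2 * INR 1 * PI) by (simpl; ring).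
  rewrite sin_period, cos_period; ring.
Qed.

Lemma is_derive_phase (a : C) (ta t : R) :
  Cmod a < 1 ->
  is_derive (phase (Cmod a) ta) t (poisson_kernel a ta t).
Proof.
  intros Ha.
  assert (Hr : 0 <= Cmod a < 1) by (split; [apply Cmod_ge_0 | exact Ha]).
  unfold phase, poisson_kernel; set (r := Cmod a) in *.
  assert (HD := phase_denominator_pos r (t - ta) Hr).
  assert (HP := poisson_denominator_pos r (t - ta) Hr).
  auto_derive; [unfold Rminus in *; lra|].
  fold (t - ta); fold (1 - r * cos (t - ta)) in *.
  replace (1 + - (r * cos (t + - ta))) with (1 - r * cos (t - ta)) by (unfold Rminus; ring).
  replace (t + - ta) with (t - ta) by ring.
  set (s := t - ta) in *; generalize (sin2_cos2 s); unfold Rsqr; intros Hs.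
  assert (Hs2 : sin s ^ 2 = 1 - cos s ^ 2) by (simpl; lra).
  field_simplify_eq.
  - rewrite ?Hs2. replace (sin s ^ 4) with ((sin s ^ 2) ^ 2) by ring. rewrite ?Hs2. ring.
  - repeat split; try lra. all: try nra.
Qed.

Lemma poisson_kernel_nonneg (a : C) (ta t : R) : Cmod a < 1 -> 0 <= poisson_kernel a ta t.
Proof.
  intros Ha; assert (H0 := Cmod_ge_0 a).
  apply Rdiv_le_0_compat; [nra | now apply poisson_denominator_pos].
Qed.

Lemma continuous_poisson_kernel (a : C) (ta t : R) :
  Cmod a < 1 -> continuous (poisson_kernel a ta) t.
Proof.
  intros Ha; apply (ex_derive_continuous (poisson_kernel a ta)); unfold poisson_kernel; auto_derive.
  generalize (poisson_denominator_pos (Cmod a) (t - ta) (conj (Cmod_ge_0 a) Ha)).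
  unfold Rminus; lra.
Qed.

Lemma continuous_phase (a : C) (ta t : R) :
  Cmod a < 1 -> continuous (phase (Cmod a) ta) t.
Proof.
  intros Ha; apply (ex_derive_continuous (phase (Cmod a) ta)).
  eexists; now apply is_derive_phase.
Qed.

(** Clearing denominators in the difference of two values B(x), B(t) of the
    Blaschke factor gives
      (B(x) - B(t)) (1 - conj(a) e^{ix}) (1 - conj(a) e^{it})
        = (1 - |a|^2) (e^{ix} - e^{it}),
    and each factor on the left has modulus at most 1 + |a|. Squared chords are
    2 (1 - cos) of the difference of the angles. *)
Lemma phase_expands (a : C) (ta x t : R) :
  Cmod a < 1 -> a = (RtoC (Cmod a) * cis ta)%C ->
  ((1 - Cmod a) / (1 + Cmod a)) ^ 2 * (1 - cos (x - t)) <=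
  1 - cos (phase (Cmod a) ta x - phase (Cmod a) ta t).
Proof.
  intros Ha Hta.
  assert (Hr := Cmod_ge_0 a).
  assert (Hx := blaschke_denominator_neq0 a x Ha).
  assert (Ht := blaschke_denominator_neq0 a t Ha).
  assert (Hw : forall y, Cmod (1 - Cconj a * cis y)%C <= 1 + Cmod a).
  { intros y; unfold Cminus.
    eapply Rle_trans; [apply Cmod_triangle|].
    rewrite Cmod_opp, Cmod_mult, Cmod_cis, Cmod_conj, Cmod_1; lra. }
  assert (Haa : (a * Cconj a)%C = RtoC (Cmod a ^ 2)).
  { rewrite Cmod_sqr; apply injective_projections; simpl; ring. }
  assert (Heq : ((cis (phase (Cmod a) ta x) - cis (phase (Cmod a) ta t))
            * ((1 - Cconj a * cis x) * (1 - Cconj a * cis t))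
          = RtoC (1 - Cmod a ^ 2) * (cis x - cis t))%C).
  { rewrite !(cis_phase a ta _ Ha Hta), RtoC_minus, <- Haa.
    field; now split. }
  apply (f_equal Cmod) in Heq; rewrite !Cmod_mult, Cmod_R, Rabs_pos_eq in Heq by nra.
  assert (Hpos := Cmod_ge_0 (cis (phase (Cmod a) ta x) - cis (phase (Cmod a) ta t))%C).
  assert (H0x := Cmod_ge_0 (1 - Cconj a * cis x)%C).
  assert (H0t := Cmod_ge_0 (1 - Cconj a * cis t)%C).
  assert (Hxt := Cmod_ge_0 (cis x - cis t)%C).
  assert (Hle : (1 - Cmod a) / (1 + Cmod a) * Cmod (cis x - cis t)%C <=
           Cmod (cis (phase (Cmod a) ta x) - cis (phase (Cmod a) ta t))%C).
  { apply Rmult_le_reg_r with ((1 + Cmod a) ^ 2); [nra|].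
    replace ((1 - Cmod a) / (1 + Cmod a) * Cmod (cis x - cis t)%C * (1 + Cmod a) ^ 2)
      with ((1 - Cmod a ^ 2) * Cmod (cis x - cis t)%C) by (field; lra).
    rewrite <- Heq; apply Rmult_le_compat_l; [exact Hpos|].
    replace ((1 + Cmod a) ^ 2) with ((1 + Cmod a) * (1 + Cmod a)) by ring.
    apply Rmult_le_compat; auto. }
  assert (Hc : 0 <= (1 - Cmod a) / (1 + Cmod a)) by (apply Rdiv_le_0_compat; lra).
  apply Rmult_le_reg_l with 2; [lra|].
  rewrite <- cis_chord_sqr.
  replace (2 * (((1 - Cmod a) / (1 + Cmod a)) ^ 2 * (1 - cos (x - t)))) with
    (((1 - Cmod a) / (1 + Cmod a)) ^ 2 * (2 * (1 - cos (x - t)))) by ring.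
  rewrite <- cis_chord_sqr, <- Rpow_mult_distr.
  apply pow_incr; split; [now apply Rmult_le_pos | exact Hle].
Qed.

(** * The Fejer kernel *)

Fixpoint dirichlet_kernel (k : nat) (u : R) : R :=
  match k with
  | O => 1
  | S m => dirichlet_kernel m u + 2 * cos (INR (S m) * u)
  end.

(** n + 1 times the Fejer kernel; without the normalisation the telescoping
    identities have no denominators. *)
Definition fejer_kernel_sum (n : nat) (u : R) : R :=
  sum_n (fun k => dirichlet_kernel k u) n.

(** Passing from k to k + 1 adds the two end terms, which are conjugate to each
    other. *)
Lemma sum_cis_dirichlet (k : nat) (u : R) :
  sum_n (fun j => cis (IZR (Z.of_nat j - Z.of_nat k) * u)) (2 * k)
  = RtoC (dirichlet_kernel k u).
Proof.
  induction k as [|k IH].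
  - simpl Nat.mul; rewrite sum_O; simpl.
    unfold cis; rewrite Rmult_0_l, cos_0, sin_0; reflexivity.
  - replace (2 * S k)%nat with (S (S (2 * k))) by lia.
    unfold sum_n; rewrite sum_Sn_m, <- sum_n_m_S, sum_n_Sm by lia.
    rewrite (sum_n_m_ext _ (fun j => cis (IZR (Z.of_nat j - Z.of_nat k) * u)))
      by (intros j; do 3 f_equal; lia).
    fold (sum_n (fun j => cis (IZR (Z.of_nat j - Z.of_nat k) * u)) (2 * k)).
    rewrite IH.
    replace (Z.of_nat 0 - Z.of_nat (S k))%Z with (- Z.of_nat (S k))%Z by lia.
    replace (Z.of_nat (S (S (2 * k))) - Z.of_nat (S k))%Z with (Z.of_nat (S k)) by lia.
    rewrite opp_IZR, <- INR_IZR_INZ, Ropp_mult_distr_l_reverse, cis_opp.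
    cbn [dirichlet_kernel].
    unfold cis, Cconj; apply injective_projections; simpl; unfold plus; simpl; ring.
Qed.

(** From 2 cos u cos(m u) = cos((m + 1) u) + cos((m - 1) u). *)
Lemma dirichlet_telescope (k : nat) (u : R) :
  (1 - cos u) * dirichlet_kernel k u = cos (INR k * u) - cos (INR (S k) * u).
Proof.
  induction k as [|k IH].
  - simpl; rewrite Rmult_0_l, cos_0, Rmult_1_l; ring.
  - cbn [dirichlet_kernel]; rewrite Rmult_plus_distr_l, IH.
    replace (INR k * u) with (INR (S k) * u - u) by (rewrite (S_INR k); ring).
    replace (INR (S (S k)) * u) with (INR (S k) * u + u) by (rewrite (S_INR (S k)); ring).
    rewrite cos_minus, cos_plus; ring.
Qed.

(** Summing [dirichlet_telescope]. The right-hand side lies in [0, 2] whatever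
    n is, which yields both the positivity of the kernel and its
    concentration. *)
Lemma fejer_telescope (n : nat) (u : R) :
  (1 - cos u) * fejer_kernel_sum n u = 1 - cos (INR (S n) * u).
Proof.
  unfold fejer_kernel_sum; induction n as [|n IH].
  - rewrite sum_O; simpl; rewrite Rmult_1_l; ring.
  - rewrite sum_Sn; unfold plus; cbn -[INR cos dirichlet_kernel sum_n].
    rewrite Rmult_plus_distr_l, IH, dirichlet_telescope; ring.
Qed.

(** Where cos u = 1 the telescoped identity is void, but there every harmonic
    equals 1. *)
Lemma dirichlet_pos_at_zero (k : nat) (u : R) : cos u = 1 -> 0 <= dirichlet_kernel k u.
Proof.
  intros Hu.
  assert (H0 : cis u = cis 0).
  { unfold cis; rewrite cos_0, sin_0, Hu; f_equal.
    generalize (sin2_cos2 u); rewrite Hu; unfold Rsqr; nra. }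
  induction k as [|k IH]; cbn [dirichlet_kernel]; [lra|].
  apply (cis_nat_multiple_eq _ _ (S k)) in H0.
  apply (f_equal fst) in H0; unfold cis in H0; cbn [fst] in H0.
  rewrite H0, Rmult_0_r, cos_0; lra.
Qed.

Lemma fejer_kernel_sum_nonneg (n : nat) (u : R) : 0 <= fejer_kernel_sum n u.
Proof.
  destruct (Req_dec (cos u) 1) as [Hu|Hu].
  - unfold fejer_kernel_sum; induction n as [|n IH].
    + rewrite sum_O; now apply dirichlet_pos_at_zero.
    + rewrite sum_Sn; apply Rplus_le_le_0_compat; [exact IH|].
      now apply dirichlet_pos_at_zero.
  - apply Rmult_le_reg_l with (1 - cos u).
    + generalize (COS_bound u); lra.
    + rewrite fejer_telescope, Rmult_0_r.
      generalize (COS_bound (INR (S n) * u)); lra.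
Qed.

(** * Integral representation of the means *)

(** Linearity of the integral gives real scalars only; a complex scalar mixes
    the two components. *)
Lemma is_RInt_Cmult (g : R -> C) (b c : R) (z l : C) :
  is_RInt (V := C_R_NormedModule) g b c l ->
  is_RInt (V := C_R_NormedModule) (fun t => (z * g t)%C) b c (z * l)%C.
Proof.
  intros Hg.
  assert (H1 := is_RInt_fct_extend_fst (U := R_NormedModule) (V := R_NormedModule) _ _ _ _ Hg).
  assert (H2 := is_RInt_fct_extend_snd (U := R_NormedModule) (V := R_NormedModule) _ _ _ _ Hg).
  apply (is_RInt_fct_extend_pair (U := R_NormedModule) (V := R_NormedModule)); simpl.
  - apply (is_RInt_minus (V := R_NormedModule)); now apply (is_RInt_scal (V := R_NormedModule)).
  - apply (is_RInt_plus (V := R_NormedModule)); now apply (is_RInt_scal (V := R_NormedModule)).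
Qed.

Lemma is_RInt_sum_n {V : NormedModule R_AbsRing} (g : nat -> R -> V) (l : nat -> V)
    (b c : R) (n : nat) :
  (forall j, is_RInt (g j) b c (l j)) ->
  is_RInt (fun t => sum_n (fun j => g j t) n) b c (sum_n l n).
Proof.
  intros H; induction n as [|n IH].
  - rewrite sum_O; apply (is_RInt_ext (g 0%nat)); [|apply H].
    intros; now rewrite sum_O.
  - rewrite sum_Sn; apply (is_RInt_ext (fun t => plus (sum_n (fun j => g j t) n) (g (S n) t))).
    + intros; now rewrite sum_Sn.
    + now apply is_RInt_plus.
Qed.

Lemma continuous_fst_C (f : R -> C) (t : R) :
  continuous f t -> continuous (fun s => fst (f s)) t.
Proof.
  intros Hf; apply (continuous_comp f fst); [exact Hf|].
  destruct (f t); apply continuous_fst.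
Qed.

Lemma continuous_snd_C (f : R -> C) (t : R) :
  continuous f t -> continuous (fun s => snd (f s)) t.
Proof.
  intros Hf; apply (continuous_comp f snd); [exact Hf|].
  destruct (f t); apply continuous_snd.
Qed.

(** The content is integrability: the integrand is continuous, which is checked
    on its real and imaginary parts. *)
Lemma is_RInt_coef (a : C) (ta : R) (f : R -> C) (k : Z) :
  Cmod a < 1 -> continuous_on_T f ->
  is_RInt (V := C_R_NormedModule)
    (fun t => (f t * cis (- (IZR k * phase (Cmod a) ta t)) * RtoC (poisson_kernel a ta t))%C)
    (- PI) PI (RtoC (2 * PI) * coef a ta (phase (Cmod a) ta) f k)%C.
Proof.
  intros Ha [_ Hf]; unfold coef.
  rewrite Cmult_assoc, <- RtoC_mult, Rinv_r, Cmult_1_l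
    by (generalize PI_RGT_0; lra).
  apply (RInt_correct (V := C_R_CompleteNormedModule)).
  assert (Hth : forall t, continuous (fun t => - (IZR k * phase (Cmod a) ta t)) t).
  { intros t; apply (continuous_opp (fun t => IZR k * phase (Cmod a) ta t)).
    apply (continuous_scal_r (IZR k) (phase (Cmod a) ta)); now apply continuous_phase. }
  assert (Hp := fun t => continuous_poisson_kernel a ta t Ha).
  assert (H1 := fun t => continuous_fst_C f t (Hf t)).
  assert (H2 := fun t => continuous_snd_C f t (Hf t)).
  assert (Hc := fun t => continuous_cos_comp _ t (Hth t)).
  assert (Hs := fun t => continuous_sin_comp _ t (Hth t)).
  assert (Hm : forall g h : R -> R, (forall t, continuous g t) -> (forall t, continuous h t) ->
     forall t, continuous (fun t => g t * h t) t).
  { intros g h Hg Hh t; now apply (continuous_mult g h). }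
  assert (Hpl : forall g h : R -> R, (forall t, continuous g t) -> (forall t, continuous h t) ->
     forall t, continuous (fun t => g t + h t) t).
  { intros g h Hg Hh t; now apply (continuous_plus g h). }
  assert (Hmi : forall g h : R -> R, (forall t, continuous g t) -> (forall t, continuous h t) ->
     forall t, continuous (fun t => g t - h t) t).
  { intros g h Hg Hh t; now apply (continuous_minus g h). }
  assert (H0 : forall t : R, continuous (fun _ : R => 0) t) by (intros; apply continuous_const).
  assert (E1 : ex_RInt (fun t => fst (f t * cis (- (IZR k * phase (Cmod a) ta t)) *
       RtoC (poisson_kernel a ta t))%C) (- PI) PI).
  { apply (ex_RInt_continuous (V := R_CompleteNormedModule)); intros t _; revert t; simpl; auto 20. }
  assert (E2 : ex_RInt (fun t => snd (f t * cis (- (IZR k * phase (Cmod a) ta t)) *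
       RtoC (poisson_kernel a ta t))%C) (- PI) PI).
  { apply (ex_RInt_continuous (V := R_CompleteNormedModule)); intros t _; revert t; simpl; auto 20. }
  destruct E1 as [l1 E1], E2 as [l2 E2]; exists (l1, l2).
  now apply (is_RInt_fct_extend_pair (U := R_NormedModule) (V := R_NormedModule)).
Qed.

Lemma is_RInt_partial_sum (a : C) (ta : R) (f : R -> C) (n : nat) (x : R) :
  Cmod a < 1 -> continuous_on_T f ->
  is_RInt (V := C_R_NormedModule)
    (fun t => (f t * RtoC (poisson_kernel a ta t) *
       RtoC (dirichlet_kernel n (phase (Cmod a) ta x - phase (Cmod a) ta t)))%C)
    (- PI) PI (RtoC (2 * PI) * partial_sum a ta (phase (Cmod a) ta) f n x)%C.
Proof.
  intros Ha Hf; unfold partial_sum; set (th := phase (Cmod a) ta).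
  eapply is_RInt_ext.
  2:{ rewrite <- (sum_n_mult_l (K := C_Ring)).
      apply (is_RInt_sum_n (V := C_R_NormedModule)).
      intros j.
      assert (H := is_RInt_coef a ta f (Z.of_nat j - Z.of_nat n) Ha Hf).
      apply (is_RInt_Cmult _ _ _ (cis (IZR (Z.of_nat j - Z.of_nat n) * th x))) in H.
      match goal with |- is_RInt _ _ _ ?z =>
        match type of H with is_RInt _ _ _ ?w => replace z with w end end.
      - exact H.
      - fold th; simpl; unfold mult; simpl. ring. }
  intros t _; simpl.
  rewrite <- sum_cis_dirichlet, <- (sum_n_mult_l (K := C_Ring)).
  apply (sum_n_ext (G := C_AbelianMonoid)); intros j; unfold mult; simpl.
  rewrite Rmult_minus_distr_l; unfold Rminus; rewrite cis_add; fold th; ring.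
Qed.

Lemma is_RInt_fejer_mean (a : C) (ta : R) (f : R -> C) (n : nat) (x : R) :
  Cmod a < 1 -> continuous_on_T f ->
  is_RInt (V := C_R_NormedModule)
    (fun t => (f t * RtoC (poisson_kernel a ta t *
       fejer_kernel_sum n (phase (Cmod a) ta x - phase (Cmod a) ta t)))%C)
    (- PI) PI
    (RtoC (2 * PI * INR (S n)) * fejer_mean a ta (phase (Cmod a) ta) f n x)%C.
Proof.
  intros Ha Hf; unfold fejer_mean.
  rewrite Nat.add_1_r, Cmult_assoc, <- RtoC_mult, Rmult_assoc, Rinv_r, Rmult_1_r
    by (apply not_0_INR; lia).
  eapply is_RInt_ext.
  2:{ rewrite <- (sum_n_mult_l (K := C_Ring)).
      apply (is_RInt_sum_n (V := C_R_NormedModule)).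
      intros k; now apply is_RInt_partial_sum. }
  intros t _; unfold fejer_kernel_sum; clear.
  induction n as [|n IH]; [rewrite !sum_O | rewrite !sum_Sn, IH].
  - rewrite RtoC_mult; symmetry; apply Cmult_assoc.
  - change (@plus R_AbelianMonoid) with Rplus.
    change (@plus (NormedModule.AbelianMonoid R_AbsRing C_R_NormedModule)) with Cplus.
    match goal with |- ?u = ?v => change (@eq C u v) end.
    rewrite !RtoC_mult, RtoC_plus; ring.
Qed.

(** Since p_a = Theta', the substitution u = Theta(t) turns this into the integral
    of D_n over one period: the constant term gives 2 pi, and every other
    harmonic has a periodic antiderivative. *)
Lemma is_RInt_poisson_dirichlet (a : C) (ta x : R) (n : nat) :
  Cmod a < 1 ->
  is_RInt (fun t => poisson_kernel a ta t *
       dirichlet_kernel n (phase (Cmod a) ta x - phase (Cmod a) ta t))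
    (- PI) PI (2 * PI).
Proof.
  intros Ha; set (th := phase (Cmod a) ta).
  assert (Hper : th PI = th (- PI) + 2 * PI).
  { unfold th; rewrite <- phase_period; f_equal; ring. }
  induction n as [|n IH]; cbn [dirichlet_kernel].
  - replace (2 * PI) with (minus (th PI) (th (- PI)))
      by (rewrite Hper; unfold minus, plus, opp; simpl; ring).
    apply (is_RInt_ext (poisson_kernel a ta)); [intros; simpl; ring|].
    apply (is_RInt_derive (V := R_CompleteNormedModule)); intros t _.
    + now apply is_derive_phase.
    + now apply continuous_poisson_kernel.
  - apply (is_RInt_ext (fun t => plus (poisson_kernel a ta t * dirichlet_kernel n (th x - th t))
       (poisson_kernel a ta t * (2 * cos (INR (S n) * (th x - th t)))))).
    { intros; unfold plus; simpl; ring. }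
    replace (2 * PI) with (plus (2 * PI) 0) by (unfold plus; simpl; ring).
    apply (is_RInt_plus (V := R_NormedModule)); [exact IH|].
    (* G is the antiderivative of the new harmonic; it takes the same value at
       both endpoints because Theta advances by exactly one period. *)
    set (G := fun t => - (2 / INR (S n)) * sin (INR (S n) * (th x - th t))).
    assert (HG : G PI = G (- PI)).
    { unfold G; rewrite Hper.
      replace (INR (S n) * (th x - (th (- PI) + 2 * PI))) with
        (- (- (INR (S n) * (th x - th (- PI))) + 2 * INR (S n) * PI)) by ring.
      rewrite sin_neg, sin_period, sin_neg; ring. }
    replace 0 with (minus (G PI) (G (- PI)))
      by (rewrite HG; unfold minus, plus, opp; simpl; ring).
    assert (Hn : INR (S n) <> 0) by (apply not_0_INR; lia).
    apply (is_RInt_derive (V := R_CompleteNormedModule)); intros t _.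
    + assert (Hd := is_derive_phase a ta t Ha); fold th in Hd.
      unfold G; clear G HG; generalize dependent (INR (S n)); intros N HN.
      auto_derive.
      * repeat split. eexists; exact Hd.
      * replace (Derive (fun x0 => th x0) t) with (poisson_kernel a ta t)
          by (symmetry; exact (is_derive_unique _ _ _ Hd)).
        unfold Rminus; field; exact HN.
    + apply (continuous_mult (poisson_kernel a ta)
        (fun t => 2 * cos (INR (S n) * (th x - th t)))).
      * now apply continuous_poisson_kernel.
      * apply (continuous_scal_r 2 (fun t => cos (INR (S n) * (th x - th t)))).
        apply (continuous_cos_comp (fun t => INR (S n) * (th x - th t))).
        apply (continuous_scal_r (INR (S n)) (fun t => th x - th t)).
        apply (continuous_minus (fun _ => th x) th); [apply continuous_const|].
        now apply continuous_phase.
Qed.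

Lemma is_RInt_poisson_fejer (a : C) (ta x : R) (n : nat) :
  Cmod a < 1 ->
  is_RInt (fun t => poisson_kernel a ta t *
       fejer_kernel_sum n (phase (Cmod a) ta x - phase (Cmod a) ta t))
    (- PI) PI (2 * PI * INR (S n)).
Proof.
  intros Ha.
  replace (2 * PI * INR (S n)) with (sum_n (fun _ => 2 * PI) n)
    by (rewrite sum_n_const; apply Rmult_comm).
  eapply is_RInt_ext.
  2:{ apply (is_RInt_sum_n (V := R_NormedModule)); intros k.
      now apply (is_RInt_poisson_dirichlet a ta x k). }
  intros t _; simpl; unfold fejer_kernel_sum.
  now rewrite (sum_n_mult_l (K := R_Ring)).
Qed.

(** * Continuity on the circle *)

Lemma periodic_int_shift (f : R -> C) (t : R) (m : Z) :
  (forall s, f (s + 2 * PI) = f s) -> f (t + 2 * PI * IZR m) = f t.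
Proof.
  intros Hf.
  assert (Hn : forall (n : nat) s, f (s + 2 * PI * INR n) = f s).
  { intros n; induction n as [|n IH]; intros s.
    - simpl; f_equal; ring.
    - rewrite S_INR, <- (Hf s), <- (IH (s + 2 * PI)); f_equal; ring. }
  destruct (Z_le_gt_dec 0 m) as [Hm|Hm].
  - rewrite <- (Z2Nat.id m), <- INR_IZR_INZ by lia; apply Hn.
  - rewrite <- (Hn (Z.to_nat (- m)) (t + 2 * PI * IZR m)), INR_IZR_INZ, Z2Nat.id by lia.
    rewrite opp_IZR; f_equal; ring.
Qed.

Lemma reduce_mod_period (y : R) : exists m : Z, - PI <= y - 2 * PI * IZR m <= PI.
Proof.
  assert (Hpi := PI_RGT_0).
  set (z := (y + PI) / (2 * PI)).
  assert (Hy : y = 2 * PI * z - PI) by (unfold z; field; lra).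
  exists (Int_part z); destruct (base_Int_part z); rewrite Hy; split; nra.
Qed.

Lemma Cmod_le_abs_sum (z : C) : Cmod z <= Rabs (fst z) + Rabs (snd z).
Proof.
  assert (H1 := Rabs_pos (fst z)); assert (H2 := Rabs_pos (snd z)).
  apply Rsqr_incr_0_var; [|lra]; rewrite !Rsqr_pow2.
  rewrite Cmod_sqr, <- (pow2_abs (fst z)), <- (pow2_abs (snd z)); nra.
Qed.

Lemma continuous_on_T_bounded (f : R -> C) :
  continuous_on_T f -> exists A, forall t, Cmod (f t) <= A.
Proof.
  intros [Hper Hf]; assert (Hpi := PI_RGT_0).
  destruct (continuity_ab_maj (fun t => Cmod (f t)) (- PI) PI) as [M [HM _]]; [lra| |].
  - intros c _; apply continuity_pt_filterlim.
    apply (continuous_ext (fun t => norm (V := C_R_NormedModule) (f t))).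
    { intros t; symmetry; apply Cmod_norm. }
    apply (continuous_comp f (norm (V := C_R_NormedModule))); [apply Hf|].
    apply (filterlim_norm (V := C_R_NormedModule)).
  - exists (Cmod (f M)); intros t.
    destruct (reduce_mod_period t) as [m Hm].
    rewrite <- (periodic_int_shift f t (- m) Hper), opp_IZR.
    apply HM; lra.
Qed.

(** Moving x into [-pi, pi] by a multiple of the period keeps t, at distance less
    than pi from it, in [-2 pi, 2 pi], where Heine's theorem applies to the two
    components of f. *)
Lemma continuous_on_T_uniform (f : R -> C) (eps : R) :
  continuous_on_T f -> 0 < eps ->
  exists delta, 0 < delta <= PI /\
    forall x t, Rabs (x - t) < delta -> Cmod (f x - f t)%C <= eps.
Proof.
  intros [Hper Hf] Heps; assert (Hpi := PI_RGT_0).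
  assert (He : 0 < eps / 2) by lra.
  destruct (Heine_cor2 (f := fun t => fst (f t)) (a := - (2 * PI)) (b := 2 * PI))
    with (eps := mkposreal _ He) as [d1 H1].
  { intros; apply continuity_pt_filterlim; now apply continuous_fst_C. }
  destruct (Heine_cor2 (f := fun t => snd (f t)) (a := - (2 * PI)) (b := 2 * PI))
    with (eps := mkposreal _ He) as [d2 H2].
  { intros; apply continuity_pt_filterlim; now apply continuous_snd_C. }
  simpl in H1, H2; assert (Hd1 := cond_pos d1); assert (Hd2 := cond_pos d2).
  exists (Rmin PI (Rmin d1 d2)); split.
  { split; [|apply Rmin_l]; repeat apply Rmin_glb_lt; assumption. }
  intros x t Hxt.
  assert (Hx1 := Rmin_l PI (Rmin d1 d2)); assert (Hx2 := Rmin_r PI (Rmin d1 d2)).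
  assert (Hx3 := Rmin_l d1 d2); assert (Hx4 := Rmin_r d1 d2).
  destruct (reduce_mod_period x) as [m Hm].
  rewrite <- (periodic_int_shift f x (- m) Hper), <- (periodic_int_shift f t (- m) Hper).
  rewrite opp_IZR.
  set (x' := x + 2 * PI * - IZR m); set (t' := t + 2 * PI * - IZR m).
  assert (Hd : Rabs (x' - t') < Rmin PI (Rmin d1 d2)).
  { replace (x' - t') with (x - t) by (unfold x', t'; ring); exact Hxt. }
  assert (Hx' : - PI <= x' <= PI) by (unfold x'; lra).
  destruct (Rabs_def2 _ _ Hd).
  assert (H1' : Rabs (fst (f x') - fst (f t')) < eps / 2) by (apply H1; lra).
  assert (H2' : Rabs (snd (f x') - snd (f t')) < eps / 2) by (apply H2; lra).
  eapply Rle_trans; [apply Cmod_le_abs_sum|].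
  simpl; unfold Rminus in *; lra.
Qed.

(** Points closer than delta modulo the period are dealt with by uniform
    continuity. For the others 1 - cos(x - t) is at least 1 - cos delta > 0, so
    M = 2 A / (1 - cos delta) absorbs the trivial bound 2 A, where A bounds |f|. *)
Lemma oscillation_le_chord (f : R -> C) (eps : R) :
  continuous_on_T f -> 0 < eps ->
  exists M, 0 <= M /\
    forall x t, Cmod (f x - f t)%C <= eps + M * (1 - cos (x - t)).
Proof.
  intros Hf Heps.
  destruct (continuous_on_T_bounded f Hf) as [A HA].
  destruct (continuous_on_T_uniform f eps Hf Heps) as [d [[Hd Hdpi] Hu]].
  assert (HA0 : 0 <= A) by (eapply Rle_trans; [apply Cmod_ge_0 | apply (HA 0)]).
  assert (Hcd : cos d < 1) by (rewrite <- cos_0; apply cos_decreasing_1; lra).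
  assert (HM : 0 <= 2 * A / (1 - cos d)) by (apply Rdiv_le_0_compat; lra).
  exists (2 * A / (1 - cos d)); split; [exact HM|]; intros x t.
  destruct (reduce_mod_period (x - t)) as [m Hm].
  set (y := x - t - 2 * PI * IZR m) in *.
  assert (Hcos : cos (x - t) = cos y).
  { assert (H := periodic_int_shift (fun s => RtoC (cos s)) y m).
    cbv beta in H; replace (y + 2 * PI * IZR m) with (x - t) in H by (unfold y; ring).
    apply RtoC_inj, H; intros s.
    f_equal; rewrite cos_plus, cos_2PI, sin_2PI; ring. }
  destruct (Rlt_le_dec (Rabs y) d) as [Hy|Hy].
  - rewrite <- (periodic_int_shift f t m (proj1 Hf)).
    assert (Cmod (f x - f (t + 2 * PI * IZR m)%R)%C <= eps).
    { apply Hu; replace (x - (t + 2 * PI * IZR m)) with y by (unfold y; ring); exact Hy. }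
    generalize (COS_bound (x - t)); nra.
  - assert (Hcy : cos y <= cos d).
    { assert (Habs : cos (Rabs y) = cos y)
        by (unfold Rabs; destruct (Rcase_abs y); [apply cos_neg | reflexivity]).
      assert (Rabs y <= PI) by (apply Rabs_le; lra).
      rewrite <- Habs; apply cos_decr_1; lra. }
    assert (H2A : Cmod (f x - f t)%C <= 2 * A).
    { unfold Cminus; eapply Rle_trans; [apply Cmod_triangle|].
      rewrite Cmod_opp; generalize (HA x) (HA t); lra. }
    assert (2 * A <= 2 * A / (1 - cos d) * (1 - cos (x - t))); [|lra].
    rewrite Hcos; replace (2 * A) with (2 * A / (1 - cos d) * (1 - cos d)) at 1 by (field; lra).
    apply Rmult_le_compat_l; lra.
Qed.

(** * Uniform convergence *)

Lemma fejer_mean_phase_congr (a : C) (ta : R) (th1 th2 : R -> R) (f : R -> C) (n : nat) (x : R) :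
  (forall t, cis (th1 t) = cis (th2 t)) ->
  fejer_mean a ta th1 f n x = fejer_mean a ta th2 f n x.
Proof.
  intros H; unfold fejer_mean; f_equal; apply sum_n_ext; intros k.
  apply sum_n_ext; intros j; cbv zeta; f_equal.
  - unfold coef; f_equal; apply RInt_ext; intros t _.
    do 2 f_equal; rewrite !cis_opp; f_equal; now apply cis_int_multiple_eq.
  - now apply cis_int_multiple_eq.
Qed.

Lemma is_RInt_RtoC (g : R -> R) (b c l : R) :
  is_RInt g b c l ->
  is_RInt (V := C_R_NormedModule) (fun t => RtoC (g t)) b c (RtoC l).
Proof.
  intros Hg.
  apply (is_RInt_fct_extend_pair (U := R_NormedModule) (V := R_NormedModule)); simpl.
  - exact Hg.
  - assert (H := is_RInt_const (V := R_NormedModule) b c 0).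
    replace (scal (c - b) (0 : R_NormedModule)) with 0 in H; [exact H|].
    symmetry; apply Rmult_0_r.
Qed.

(** f(x) - sigma_n(f)(x) is the integral of f(x) - f(t) against a kernel of mass
    1. In the integrand the oscillation of f is at most
    eps + M/c (1 - cos(Theta(x) - Theta(t))), where c is the constant of
    [phase_expands]. The first term contributes eps; multiplying the second by
    K_n leaves at most 2 M/c, integrated against p_a of mass 2 pi: after division
    by 2 pi (n + 1) this is O(1/n), uniformly in x. *)
Lemma fejer_mean_error (a : C) (ta eps : R) (f : R -> C) :
  Cmod a < 1 -> a = (RtoC (Cmod a) * cis ta)%C -> continuous_on_T f -> 0 < eps ->
  exists M, 0 <= M /\ forall n x,
    Cmod (f x - fejer_mean a ta (phase (Cmod a) ta) f n x)%C <= eps + M / INR (S n).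
Proof.
  intros Ha Hta Hf Heps; assert (Hpi := PI_RGT_0).
  destruct (oscillation_le_chord f eps Hf Heps) as [M [HM Hosc]].
  set (th := phase (Cmod a) ta); set (p := poisson_kernel a ta).
  set (c := ((1 - Cmod a) / (1 + Cmod a)) ^ 2).
  assert (Hc : 0 < c).
  { assert (H := Cmod_ge_0 a); apply pow_lt, Rdiv_lt_0_compat; lra. }
  assert (HMc : 0 <= M / c) by (apply Rdiv_le_0_compat; lra).
  exists (2 * (M / c)); split; [lra|]; intros n x.
  assert (HN : 0 < INR (S n)) by (apply lt_0_INR; lia).
  set (K := fun t => fejer_kernel_sum n (th x - th t)).
  assert (I1 := is_RInt_fejer_mean a ta f n x Ha Hf).
  assert (I2 := is_RInt_poisson_fejer a ta x n Ha).
  assert (I3 := is_RInt_poisson_dirichlet a ta x 0 Ha).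
  fold th p in I1, I2, I3.
  (* I5 integrates the difference to be estimated, I6 its pointwise majorant. *)
  assert (I4 := is_RInt_Cmult _ _ _ (f x) _ (is_RInt_RtoC _ _ _ _ I2)).
  assert (I5 := is_RInt_minus (V := C_R_NormedModule) _ _ _ _ _ _ I4 I1).
  assert (I6 := is_RInt_plus (V := R_NormedModule) _ _ _ _ _ _
     (is_RInt_scal (V := R_NormedModule) _ _ _ eps _ I2)
     (is_RInt_scal (V := R_NormedModule) _ _ _ (2 * (M / c)) _ I3)).
  assert (Hle := fun H => norm_RInt_le (V := C_R_NormedModule) _ _ (- PI) PI _ _
     ltac:(lra) H I5 I6).
  assert (Hfinal : 2 * PI * INR (S n) * Cmod (f x - fejer_mean a ta th f n x)%C
     <= eps * (2 * PI * INR (S n)) + 2 * (M / c) * (2 * PI)).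
  { replace (2 * PI * INR (S n) * Cmod (f x - fejer_mean a ta th f n x)%C)
      with (Cmod (f x * RtoC (2 * PI * INR (S n)) -
         RtoC (2 * PI * INR (S n)) * fejer_mean a ta th f n x)%C).
    - rewrite Cmod_norm; apply Hle; clear Hle; intros t _.
      eapply Rle_trans; [apply Req_le; symmetry; apply Cmod_norm|].
      change (Cmod (f x * RtoC (p t * K t) - f t * RtoC (p t * K t))%C
        <= eps * (p t * K t) + 2 * (M / c) * (p t * 1)).
      assert (Hp : 0 <= p t) by now apply poisson_kernel_nonneg.
      assert (HK : 0 <= K t) by apply fejer_kernel_sum_nonneg.
      assert (Htel : (1 - cos (th x - th t)) * K t <= 2).
      { unfold K; rewrite fejer_telescope.
        generalize (COS_bound (INR (S n) * (th x - th t))); lra. }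
      assert (Hexp := phase_expands a ta x t Ha Hta); fold c th in Hexp.
      assert (Hosc' : Cmod (f x - f t)%C <= eps + M / c * (1 - cos (th x - th t))).
      { eapply Rle_trans; [apply Hosc|]; apply Rplus_le_compat_l.
        replace (M * (1 - cos (x - t))) with (M / c * (c * (1 - cos (x - t)))) by (field; lra).
        now apply Rmult_le_compat_l. }
      replace (f x * RtoC (p t * K t) - f t * RtoC (p t * K t))%C
        with (RtoC (p t * K t) * (f x - f t))%C by ring.
      assert (HpK : 0 <= p t * K t) by now apply Rmult_le_pos.
      rewrite Cmod_mult, Cmod_R, Rabs_pos_eq by exact HpK.
      eapply Rle_trans; [apply Rmult_le_compat_l; [exact HpK | exact Hosc']|].
      assert (M / c * p t * ((1 - cos (th x - th t)) * K t) <= M / c * p t * 2).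
      { apply Rmult_le_compat_l; [now apply Rmult_le_pos | exact Htel]. }
      lra.
    - replace (f x * RtoC (2 * PI * INR (S n)) -
         RtoC (2 * PI * INR (S n)) * fejer_mean a ta th f n x)%C
        with (RtoC (2 * PI * INR (S n)) * (f x - fejer_mean a ta th f n x))%C by ring.
      rewrite Cmod_mult, Cmod_R, Rabs_pos_eq; [reflexivity|].
      apply Rmult_le_pos; lra. }
  apply Rmult_le_reg_l with (2 * PI * INR (S n)); [apply Rmult_lt_0_compat; lra|].
  eapply Rle_trans; [exact Hfinal|]; apply Req_le; field; lra.
Qed.

Lemma sup_norm_bounded (g : R -> C) (B : R) :
  (forall x, Cmod (g x) <= B) ->
  is_finite (sup_norm g) /\ 0 <= real (sup_norm g) <= B.
Proof.
  intros HB.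
  destruct (Lub_Rbar_correct (fun r => exists x, r = Cmod (g x))) as [Hub Hlub].
  fold (sup_norm g) in Hub, Hlub.
  assert (H1 : Rbar_le (sup_norm g) B).
  { apply Hlub; intros r [x ->]; apply HB. }
  assert (H2 : Rbar_le (Cmod (g 0)) (sup_norm g)) by (apply Hub; now exists 0).
  destruct (sup_norm g) as [s| |]; simpl in *; try contradiction.
  split; [reflexivity|]; split; [|exact H1].
  eapply Rle_trans; [apply Cmod_ge_0 | exact H2].
Qed.

Theorem theorem8 :
  forall (a : C) (ta : R) (theta : R -> R) (f : R -> C),
    Cmod a < 1 ->
    a = (RtoC (Cmod a) * cis ta)%C ->
    nonlinear_phase a theta ->
    continuous_on_T f ->
    (forall n : nat,
       is_finite (sup_norm (fun x : R => (f x - fejer_mean a ta theta f n x)%C)))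
    /\
    is_lim_seq
      (fun n : nat =>
         real (sup_norm (fun x : R => (f x - fejer_mean a ta theta f n x)%C)))
      0.
Proof.
  intros a ta theta f Ha Hta [_ Htheta] Hf.
  assert (Hsup : forall eps, 0 < eps -> exists M, 0 <= M /\ forall n,
    is_finite (sup_norm (fun x => (f x - fejer_mean a ta theta f n x)%C)) /\
    0 <= real (sup_norm (fun x => (f x - fejer_mean a ta theta f n x)%C))
      <= eps + M / INR (S n)).
  { intros eps Heps.
    destruct (fejer_mean_error a ta eps f Ha Hta Hf Heps) as [M [HM HE]].
    exists M; split; [exact HM|]; intros n; apply sup_norm_bounded; intros x.
    rewrite (fejer_mean_phase_congr a ta theta (phase (Cmod a) ta)); [apply HE|].
    intros t; rewrite Htheta; symmetry; now apply cis_phase. }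
  split.
  - intros n; destruct (Hsup 1 Rlt_0_1) as [M [_ H]]; apply H.
  - apply is_lim_seq_spec; intros eps.
    assert (He : 0 < eps / 2) by (generalize (cond_pos eps); lra).
    destruct (Hsup _ He) as [M [HM H]].
    destruct (nfloor_ex (M / (eps / 2))) as [N HN]; [now apply Rdiv_le_0_compat|].
    exists N; intros n Hn; destruct (H n) as [_ [H0 H1]].
    rewrite Rminus_0_r, Rabs_pos_eq by exact H0.
    assert (HSn : M / (eps / 2) < INR (S n)).
    { rewrite S_INR; apply le_INR in Hn; lra. }
    assert (Hpos : 0 < INR (S n)) by (apply lt_0_INR; lia).
    assert (M / INR (S n) < eps / 2); [|lra].
    apply Rmult_lt_reg_r with (INR (S n)); [exact Hpos|].
    apply (Rmult_lt_compat_r (eps / 2)) in HSn; [|exact He].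
    replace (M / (eps / 2) * (eps / 2)) with M in HSn by (field; lra).
    replace (M / INR (S n) * INR (S n)) with M by (field; lra).
    lra.
Qed.
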